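(* Let $(S,\diamond)$ be a finite loop and for $a\in S$ let $\ell_a:S\to S$, $\ell_a(x)=a\diamond x$. Then the relations $\{(x,\ell_a(x)):x\in S\}$, $a\in S$, form a thin Jordan scheme on $S$ if and only if $(S,\diamond)$ is an RA-loop.
   Context: $\mathbb{F}$ a field with $\mathrm{char}\,\mathbb{F}\neq2$, $A\star B=\tfrac12(AB+BA)$. A Jordan scheme on a finite set $\Omega$ is a partition $S$ of $\Omega\times\Omega$ into nonempty relations with $1_\Omega=\{(\omega,\omega)\}\in S$, $s^t=\{(\beta,\alpha):(\alpha,\beta)\in s\}\in S$ for all $s\in S$, and such that the $\mathbb{F}$-span of the $0/1$ adjacency matrices of the $s\in S$ is closed under $\star$; it is thin if each basic relation has, for each point, at most one out-neighbour and at most one in-neighbour. A loop $(S,\diamond)$ is a ring-alternative loop (RA-loop) if for every commutative associative ring $R$ the loop ring $RS$ is an alternative ring, i.e. satisfies $(xx)y=x(xy)$ and $(yx)x=y(xx)$ for all $x,y\in RS$. *)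

(* Defs.v *)
From mathcomp Require Import all_boot all_order all_algebra.

Set Implicit Arguments.
Unset Strict Implicit.
Unset Printing Implicit Defensive.

Import GRing.Theory.
Local Open Scope ring_scope.

Definition jordan_mul (F : fieldType) (n : nat) (A B : 'M[F]_n) : 'M[F]_n :=
  2%:R^-1 *: (A *m B + B *m A).

Definition diag_rel (Omega : finType) : {set Omega * Omega} :=
  [set p | p.1 == p.2].

Definition converse_rel (Omega : finType) (s : {set Omega * Omega}) :
    {set Omega * Omega} :=
  [set p | (p.2, p.1) \in s].

(* Rows and columns are indexed by 'I_#|Omega| through the enumeration of
   Omega, since MathComp matrices are indexed by ordinals. *)
Definition adjacency_mx (F : fieldType) (Omega : finType)
    (s : {set Omega * Omega}) : 'M[F]_#|Omega| :=
  \matrix_(i, j) ((enum_val i, enum_val j) \in s)%:R.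

Definition adjacency_span (F : fieldType) (Omega : finType)
    (P : {set {set Omega * Omega}}) : {vspace 'M[F]_#|Omega|} :=
  <<[seq adjacency_mx F s | s <- enum P]>>%VS.

(* [partition] includes the requirement that no block is empty. *)
Definition jordan_scheme (F : fieldType) (Omega : finType)
    (P : {set {set Omega * Omega}}) : Prop :=
  [/\ partition P [set: Omega * Omega],
      diag_rel Omega \in P,
      forall s, s \in P -> converse_rel s \in P
    & forall A B, A \in adjacency_span F P -> B \in adjacency_span F P ->
        jordan_mul A B \in adjacency_span F P].

Definition thin (Omega : finType) (P : {set {set Omega * Omega}}) : Prop :=
  forall s, s \in P -> forall x : Omega,
    (#|[set y | (x, y) \in s]| <= 1)%N /\ (#|[set y | (y, x) \in s]| <= 1)%N.

Definition is_loop (S : Type) (op : S -> S -> S) : Prop :=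
  (exists e, left_id e op /\ right_id e op) /\
  (forall a, bijective (op a) /\ bijective (op^~ a)).

(* Multiplication of the loop ring RS: f stands for the formal sum of the
   f x times x, and addition is the pointwise one of {ffun S -> R}. *)
Definition loop_ring_mul (R : comPzRingType) (S : finType) (op : S -> S -> S)
    (f g : {ffun S -> R}) : {ffun S -> R} :=
  [ffun z => \sum_x \sum_(y | op x y == z) f x * g y].

Definition alternative (V : Type) (mul : V -> V -> V) : Prop :=
  forall x y, mul (mul x x) y = mul x (mul x y) /\
              mul (mul y x) x = mul y (mul x x).

Definition RA_loop (S : finType) (op : S -> S -> S) : Prop :=
  is_loop op /\
  forall R : comPzRingType, alternative (@loop_ring_mul R S op).

Definition left_mul_rel (S : finType) (op : S -> S -> S) (a : S) :
    {set S * S} :=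
  [set (x, op a x) | x : S].

Definition left_mul_rels (S : finType) (op : S -> S -> S) :
    {set {set S * S}} :=
  [set left_mul_rel op a | a : S].

(* Main.v *)
(** Both sides amount to the multiset identity
    {a(bx), b(ax)} = {(ab)x, (ba)x}.  Over any field of characteristic other
    than 2 the entries 0, 1, 2 of A_a A_b + A_b A_a are distinct, so closure
    under the Jordan product is exactly this identity; over any commutative
    ring it is the linearised left alternative law.  The right alternative law
    is obtained from it as follows.  At x = a^-1 the identity gives
    (ba)a^-1 = b or (ab)a^-1 = b.  In the latter case a^-1 commutes with ab, so
    left multiplication by ab is the composite of those by a and b, and the
    identity at x = a^-1 again yields (ba)a^-1 = b.  Hence the loop has the
    inverse property, (xy)^-1 = y^-1 x^-1, and inversion exchanges the left and
    right laws. *)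
Require Import Defs.
From mathcomp Require Import all_boot all_order all_algebra.
Set Implicit Arguments.
Unset Strict Implicit.
Unset Printing Implicit Defensive.
Import GRing.Theory.
Local Open Scope ring_scope.

(** * Loops satisfying the linearised left alternative law *)

Definition left_alternating (S : Type) (op : S -> S -> S) : Prop :=
  forall a b x,
    (op a (op b x) = op (op a b) x /\ op b (op a x) = op (op b a) x) \/
    (op a (op b x) = op (op b a) x /\ op b (op a x) = op (op a b) x).

Definition opposite (S : Type) (op : S -> S -> S) : S -> S -> S :=
  fun a b => op b a.

(** Since 2 is nonzero, 0, 1 and 2 are pairwise distinct in [R], so the hypothesis counts
    multiplicities; comparing them at [y = p] and [y = q] suffices. *)
Lemma eq_pair_of_indicators (R : nzRingType) (T : eqType) (p q r s : T) :
  2%:R != 0 :> R ->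
  (forall y, (p == y)%:R + (q == y)%:R = (r == y)%:R + (s == y)%:R :> R) ->
  (p = r /\ q = s) \/ (p = s /\ q = r).
Proof.
move=> two_neq0 eq_ind.
have neq21 : (2%:R == 1 :> R) = false.
  by rewrite -subr_eq0 mulr2n addrK oner_eq0.
have := eq_ind p; have := eq_ind q; rewrite !eqxx (eq_sym q p).
case: (eqVneq p q) => [<-|neq_pq].
  rewrite (eq_sym r) (eq_sym s) => _.
  case: (eqVneq p r) => [<-|_]; case: (eqVneq p s) => [<-|_] /=; first by left.
  - by rewrite -[1%:R + 1%:R]/(2%:R) addr0 => /eqP; rewrite neq21.
  - by rewrite -[1%:R + 1%:R]/(2%:R) add0r => /eqP; rewrite neq21.
  - by rewrite -[1%:R + 1%:R]/(2%:R) addr0 => /eqP; rewrite (negPf two_neq0).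
rewrite /= add0r addr0.
case: (eqVneq r p) => [->|_]; case: (eqVneq s p) => [->|_] /=.
- by move=> _ /eqP; rewrite eq_sym -[1%:R + 1%:R]/(2%:R) neq21.
- rewrite (negPf neq_pq) add0r; case: (eqVneq s q) => [->|_]; first by left.
  by move/eqP; rewrite oner_eq0.
- rewrite (negPf neq_pq) addr0; case: (eqVneq r q) => [->|_]; first by right.
  by move/eqP; rewrite oner_eq0.
- by move=> _ /eqP; rewrite addr0 oner_eq0.
Qed.

(** When [a] and [b] commute, both alternatives coincide; [b = a] gives the left alternative law. *)
Lemma left_alternating_comm (S : Type) (op : S -> S -> S) (a b : S) :
  left_alternating op -> op a b = op b a ->
  forall x, op a (op b x) = op (op a b) x.
Proof. by move=> alt_op ab x; case: (alt_op a b x) => -[-> _] //; rewrite ab. Qed.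

Lemma left_alternating_RIP (S : Type) (op : S -> S -> S) (e : S)
    (inv : S -> S) :
  right_id e op -> left_alternating op ->
  (forall a, cancel (op a) (op (inv a))) ->
  (forall a, cancel (op (inv a)) (op a)) ->
  forall a b, op (op b a) (inv a) = b.
Proof.
move=> op1 alt_op invK Kinv a b.
have aV : op a (inv a) = e by rewrite -[inv a]op1 Kinv.
case: (alt_op a b (inv a)) => -[eq1 eq2]; first by rewrite -eq2 aV op1.
have abV : op (op a b) (inv a) = b by rewrite -eq2 aV op1.
have comm : op (inv a) (op a b) = op (op a b) (inv a) by rewrite invK.
(* Evaluated at [inv a], this says that [b] commutes with [inv a], whence a(b a^-1) = a(a^-1 b) =
   b. *)
have := left_alternating_comm alt_op comm (inv a).
by rewrite invK abV -eq1 => <-; rewrite Kinv.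
Qed.

Lemma left_alternating_opposite (S : Type) (op : S -> S -> S) (e : S)
    (inv : S -> S) :
  left_id e op -> right_id e op -> left_alternating op ->
  (forall a, cancel (op a) (op (inv a))) ->
  (forall a, cancel (op (inv a)) (op a)) ->
  left_alternating (opposite op).
Proof.
move=> op1l op1r alt_op invK Kinv.
have RIP := left_alternating_RIP op1r alt_op invK Kinv.
have invM x y : inv (op x y) = op (inv y) (inv x).
  (* Here y^-1 = (xy)^-1 ((xy) y^-1) = (xy)^-1 x, and multiplying by x^-1 on the right cancels x. *)
  by rewrite -[X in _ = op X _](invK (op x y)) !RIP.
have inv_inj : injective inv.
  apply: (can_inj (g := inv)) => z; rewrite -[LHS]op1r.
  by rewrite -[X in op _ X](_ : op (inv z) z = e) ?invK // -[X in op _ X]op1r invK.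
move=> a b x; rewrite /opposite.
by case: (alt_op (inv a) (inv b) (inv x)); rewrite -!invM => -[];
  move=> /inv_inj-> /inv_inj->; [left | right].
Qed.

(** Adding a sum to its transpose would prove the claim only up to a factor 2, which may be a zero
    divisor in the coefficients. Instead each off-diagonal term is paired once with its mirror
    image, along the total order given by [enum_rank]. *)
Lemma eq_double_sum (V : zmodType) (I : finType) (T T' : I -> I -> V) :
  (forall a, T a a = T' a a) ->
  (forall a b, T a b + T b a = T' a b + T' b a) ->
  \sum_a \sum_b T a b = \sum_a \sum_b T' a b.
Proof.
move=> eq_diag eq_sym2.
pose lt (a b : I) := (enum_rank a < enum_rank b)%N.
have split_sum (U : I -> I -> V) : \sum_a \sum_b U a b =
    \sum_a U a a + \sum_a \sum_(b | lt a b) (U a b + U b a).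
  transitivity (\sum_a (U a a + (\sum_(b | lt a b) U a b
                                 + \sum_(b | lt b a) U a b))).
    apply: eq_bigr => a _; rewrite (bigD1 a) //=; congr (_ + _).
    rewrite (bigID (lt a)) /=; congr (_ + _); apply: eq_bigl => b;
      rewrite /lt -(inj_eq enum_rank_inj) -(inj_eq val_inj) /=;
      by case: ltngtP.
  rewrite !big_split /=; congr (_ + _).
  under [X in _ = X]eq_bigr do rewrite big_split.
  rewrite big_split /=; congr (_ + _).
  by rewrite (exchange_big_dep xpredT).
rewrite !split_sum; congr (_ + _); first exact: eq_bigr.
by apply: eq_bigr => a _; apply: eq_bigr.
Qed.

(** * Alternative laws in loop rings *)

Lemma loop_ring_mulE (R : comPzRingType) (S : finType) (op : S -> S -> S)
    (f g : {ffun S -> R}) z :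
  loop_ring_mul op f g z =
    \sum_x \sum_y (op x y == z)%:R * (f x * g y).
Proof.
rewrite ffunE; apply: eq_bigr => x _; rewrite big_mkcond.
by apply: eq_bigr => y _; case: eqP; rewrite ?mul1r ?mul0r.
Qed.

Lemma sum_indicator (R : pzRingType) (S : finType) (u : S) (F : S -> R) :
  \sum_v (u == v)%:R * F v = F u.
Proof.
rewrite (bigD1 u) //= eqxx mul1r big1 ?addr0 // => v.
by rewrite eq_sym => /negPf->; rewrite mul0r.
Qed.

Lemma loop_ring_mul_left (R : comPzRingType) (S : finType)
    (op : S -> S -> S) (f g h : {ffun S -> R}) z :
  loop_ring_mul op (loop_ring_mul op f g) h z =
    \sum_a \sum_b \sum_x (op (op a b) x == z)%:R * (f a * g b * h x).
Proof.
rewrite loop_ring_mulE.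
transitivity (\sum_u \sum_a \sum_b (op a b == u)%:R *
    \sum_x (op u x == z)%:R * (f a * g b * h x)).
  apply: eq_bigr => u _.
  under eq_bigr do
    rewrite loop_ring_mulE mulr_suml mulr_sumr.
  rewrite exchange_big; apply: eq_bigr => a _.
  under eq_bigr do rewrite mulr_suml mulr_sumr.
  rewrite exchange_big; apply: eq_bigr => b _.
  rewrite mulr_sumr; apply: eq_bigr => x _.
  by rewrite -mulrA mulrCA.
rewrite exchange_big; apply: eq_bigr => a _.
rewrite exchange_big; apply: eq_bigr => b _.
exact: (sum_indicator (op a b)
  (fun u => \sum_x (op u x == z)%:R * (f a * g b * h x))).
Qed.

Lemma loop_ring_mul_right (R : comPzRingType) (S : finType)
    (op : S -> S -> S) (f g h : {ffun S -> R}) z :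
  loop_ring_mul op f (loop_ring_mul op g h) z =
    \sum_a \sum_b \sum_x (op a (op b x) == z)%:R * (f a * g b * h x).
Proof.
rewrite loop_ring_mulE; apply: eq_bigr => a _.
transitivity (\sum_u \sum_b \sum_x (op b x == u)%:R *
    ((op a u == z)%:R * (f a * g b * h x))).
  apply: eq_bigr => u _; rewrite loop_ring_mulE !mulr_sumr.
  apply: eq_bigr => b _; rewrite !mulr_sumr; apply: eq_bigr => x _.
  by rewrite -!mulrA [RHS]mulrCA; congr (_ * _); rewrite mulrCA.
rewrite exchange_big; apply: eq_bigr => b _.
rewrite exchange_big; apply: eq_bigr => x _.
exact: (sum_indicator (op b x)
  (fun u => (op a u == z)%:R * (f a * g b * h x))).
Qed.

(** Commutativity of [R] turns the right alternative law into the left one for the opposite loop. *)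
Lemma loop_ring_mul_opposite (R : comPzRingType) (S : finType)
    (op : S -> S -> S) (f g : {ffun S -> R}) :
  loop_ring_mul (opposite op) f g = loop_ring_mul op g f.
Proof.
apply/ffunP => z; rewrite !loop_ring_mulE exchange_big.
by apply: eq_bigr => x _; apply: eq_bigr => y _; rewrite [f y * _]mulrC.
Qed.

(** The coefficient [f a * f b] is symmetric in [a] and [b], so the terms of (a, b) and (b, a) may
    be compared together, which is what the law on the loop controls. *)
Lemma loop_ring_left_alternative (R : comPzRingType) (S : finType)
    (op : S -> S -> S) :
  left_alternating op -> forall f g : {ffun S -> R},
  loop_ring_mul op (loop_ring_mul op f f) g =
  loop_ring_mul op f (loop_ring_mul op f g).
Proof.
move=> alt_op f g; apply/ffunP => z.
rewrite loop_ring_mul_left loop_ring_mul_right.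
apply: eq_double_sum => [a | a b].
  by apply: eq_bigr => x _; rewrite (left_alternating_comm alt_op).
rewrite -!big_split /=; apply: eq_bigr => x _.
rewrite [f b * f a]mulrC -!mulrDl; congr (_ * _).
by case: (alt_op a b x) => -[-> ->] //; rewrite addrC.
Qed.

(** Linearisation over the integers: expand the law at [delta a + delta b] and [delta x], cancel the
    square terms, and read the pair off the indicators. *)
Lemma left_alternating_of_loop_ring (S : finType) (op : S -> S -> S) :
  (forall f g : {ffun S -> int},
     loop_ring_mul op (loop_ring_mul op f f) g =
     loop_ring_mul op f (loop_ring_mul op f g)) ->
  left_alternating op.
Proof.
move=> alt_ring a b x.
apply: (@eq_pair_of_indicators int _ _ _ _ _ isT) => z.
pose delta u : {ffun S -> int} := [ffun v => (u == v)%:R].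
have sum_delta u (G : S -> int) : \sum_v delta u v * G v = G u.
  by under eq_bigr do rewrite ffunE; rewrite sum_indicator.
have sum3 u v (G : S -> S -> S -> int) :
    \sum_p \sum_q \sum_y G p q y * (delta u p * delta v q * delta x y)
    = G u v x.
  rewrite -(sum_delta u (fun p => G p v x)); apply: eq_bigr => p _.
  rewrite -(sum_delta v (fun q => G p q x)) mulr_sumr; apply: eq_bigr => q _.
  rewrite -(sum_delta x (G p q)) !mulr_sumr; apply: eq_bigr => y _.
  by rewrite mulrC !mulrA.
have sum3D (G : S -> S -> S -> int) :
    \sum_p \sum_q \sum_y G p q y *
      ((delta a + delta b) p * (delta a + delta b) q * delta x y)
    = G a a x + G b b x + (G a b x + G b a x).
  rewrite -!sum3 -!big_split; apply: eq_bigr => p _.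
  rewrite -!big_split; apply: eq_bigr => q _.
  rewrite -!big_split; apply: eq_bigr => y _.
  rewrite !ffunE /= -!mulrDr -!mulrDl; congr (_ * (_ * _)).
  by rewrite mulrDl !mulrDr [X in _ + X]addrC addrACA.
have sq u : op (op u u) x = op u (op u x).
  move/ffunP: (alt_ring (delta u) (delta x)) => /(_ (op (op u u) x)).
  rewrite loop_ring_mul_left loop_ring_mul_right.
  rewrite (sum3 _ _ (fun p q y => (op (op p q) y == _)%:R)).
  rewrite (sum3 _ _ (fun p q y => (op p (op q y) == _)%:R)) eqxx.
  by case: eqP.
move/ffunP: (alt_ring (delta a + delta b) (delta x)) => /(_ z).
rewrite loop_ring_mul_left loop_ring_mul_right.
rewrite (sum3D (fun p q y => (op (op p q) y == _)%:R)).
rewrite (sum3D (fun p q y => (op p (op q y) == _)%:R)).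
by rewrite !sq => /addrI ->.
Qed.

Lemma loop_ring_alternativeP (S : finType) (op : S -> S -> S) :
  (forall R : comPzRingType, alternative (@loop_ring_mul R S op)) <->
  left_alternating op /\ left_alternating (opposite op).
Proof.
split=> [alt_ring | [altl altr] R f g].
  split; apply: left_alternating_of_loop_ring => f g.
    by case: (alt_ring int f g).
  by rewrite !(loop_ring_mul_opposite op); case: (alt_ring int f g).
split; first exact: loop_ring_left_alternative.
by rewrite -!(loop_ring_mul_opposite op) loop_ring_left_alternative.
Qed.

Lemma alternating_left_inverse (S : Type) (op : S -> S -> S) (e a a' : S) :
  left_id e op -> right_id e op -> injective (op a') -> injective (op^~ a') ->
  left_alternating op -> left_alternating (opposite op) ->
  op a' a = e -> cancel (op a) (op a').
Proof.
move=> op1l op1r injl injr altl altr a'a.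
have aa' : op a a' = e.
  case: (altl a' a a') => -[eq1 eq2].
    by apply: injl; rewrite eq1 a'a op1l op1r.
  (* In this case a' = (a'a)a' = a(a'a'), which the right alternative law turns into (aa')a'; then
     a' cancels on the right. *)
  apply: injr; rewrite op1l -[RHS]op1l -[in RHS]a'a -eq2.
  exact: (left_alternating_comm altr).
by move=> x; rewrite (left_alternating_comm altl) ?a'a ?aa' ?op1l.
Qed.

(** * Relations and adjacency matrices of left multiplications *)

Lemma left_mul_rel_in (S : finType) (op : S -> S -> S) a :
  left_mul_rel op a \in left_mul_rels op.
Proof. exact: imset_f. Qed.

Lemma mem_left_mul_rel (S : finType) (op : S -> S -> S) a x y :
  ((x, y) \in left_mul_rel op a) = (op a x == y).
Proof.
apply/imsetP/eqP => [[z _ [-> ->]] // | <-].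
by exists x.
Qed.

(** Right multiplication by x is bijective, so ax = y has exactly one solution a for each pair (x,
    y). *)
Lemma left_mul_rels_partition (S : finType) (op : S -> S -> S) :
  is_loop op -> partition (left_mul_rels op) [set: S * S].
Proof.
move=> [[e _] op_bij]; apply/and3P; split.
- rewrite eqEsubset subsetT /=; apply/subsetP => -[x y] _.
  have [_ [g _ gK]] := op_bij x; apply/bigcupP.
  exists (left_mul_rel op (g y)); first exact: left_mul_rel_in.
  by rewrite mem_left_mul_rel gK.
- apply/trivIsetP => _ _ /imsetP[a _ ->] /imsetP[b _ ->] neq_ab.
  rewrite -setI_eq0; apply: contraNT neq_ab => /set0Pn[[x y]].
  rewrite inE !mem_left_mul_rel => /andP[/eqP <- /eqP].
  by have [_ /bij_inj inj] := op_bij x; move/inj=> ->.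
- apply/imsetP => -[a _ /setP/(_ (e, op a e))].
  by rewrite in_set0 mem_left_mul_rel eqxx.
Qed.

Lemma left_mul_rels_thin (S : finType) (op : S -> S -> S) :
  is_loop op -> thin (left_mul_rels op).
Proof.
move=> [_ op_bij] _ /imsetP[a _ ->] x; split; apply/card_le1_eqP => y z;
  rewrite !inE !mem_left_mul_rel => /eqP hy /eqP hz; first by rewrite -hy.
by have [/bij_inj inj _] := op_bij a; apply: inj; rewrite hy.
Qed.

Lemma diag_left_mul_rel (S : finType) (op : S -> S -> S) e :
  left_id e op -> left_mul_rel op e = diag_rel S.
Proof.
by move=> op1; apply/setP => -[x y]; rewrite mem_left_mul_rel op1 inE.
Qed.

Lemma adjacency_left_mulE (F : fieldType) (S : finType) (op : S -> S -> S)
    a i j :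
  adjacency_mx F (left_mul_rel op a) i j =
    (op a (enum_val i) == enum_val j)%:R.
Proof. by rewrite mxE mem_left_mul_rel. Qed.

(** Rows index sources, so the matrix product applies [a] first and reverses the order of
    composition. *)
Lemma adjacency_mulmxE (F : fieldType) (S : finType) (op : S -> S -> S)
    a b i j :
  (adjacency_mx F (left_mul_rel op a) *m adjacency_mx F (left_mul_rel op b))
    i j = (op b (op a (enum_val i)) == enum_val j)%:R.
Proof.
rewrite mxE (bigD1 (enum_rank (op a (enum_val i)))) //=.
rewrite !adjacency_left_mulE enum_rankK eqxx mul1r big1 ?addr0 // => k.
rewrite adjacency_left_mulE => neq_k; case: eqP => [eq_k|]; last by rewrite mul0r.
by rewrite eq_k enum_valK eqxx in neq_k.
Qed.

Lemma jordan_mul_adjacencyE (F : fieldType) (S : finType) (op : S -> S -> S)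
    a b i j :
  jordan_mul (adjacency_mx F (left_mul_rel op a))
    (adjacency_mx F (left_mul_rel op b)) i j =
  2%:R^-1 * ((op b (op a (enum_val i)) == enum_val j)%:R +
             (op a (op b (enum_val i)) == enum_val j)%:R).
Proof.
by rewrite [LHS]mxE; congr (_ * _); rewrite [LHS]mxE !adjacency_mulmxE.
Qed.

Lemma adjacency_mem_span (F : fieldType) (S : finType) (op : S -> S -> S) a :
  adjacency_mx F (left_mul_rel op a) \in
    adjacency_span F (left_mul_rels op).
Proof. by apply/memv_span/map_f; rewrite mem_enum left_mul_rel_in. Qed.

(** The pairs (x, ax) and (y, ay) lie in the same relation and in no other, so each generator has
    equal entries there. *)
Lemma adjacency_span_const (F : fieldType) (S : finType) (op : S -> S -> S)
    A a x y :
  is_loop op -> A \in adjacency_span F (left_mul_rels op) ->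
  A (enum_rank x) (enum_rank (op a x)) = A (enum_rank y) (enum_rank (op a y)).
Proof.
move=> [_ op_bij].
move/(@coord_span _ _ _ (in_tuple _))=> ->.
rewrite !summxE; apply: eq_bigr => i _; rewrite ![in LHS]mxE ![in RHS]mxE.
congr (_ * _).
have /mapP[s] := mem_nth 0 (ltn_ord i).
rewrite mem_enum => /imsetP[c _ ->] ->.
rewrite !adjacency_left_mulE !enum_rankK.
have [_ /bij_inj injx] := op_bij x; have [_ /bij_inj injy] := op_bij y.
by rewrite (inj_eq injx) (inj_eq injy).
Qed.

Lemma two_neq0 (F : fieldType) : 2%N \notin [pchar F] -> 2%:R != 0 :> F.
Proof. by rewrite inE. Qed.

Lemma jordan_closed_left_alternating (F : fieldType) (S : finType)
    (op : S -> S -> S) :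
  2%N \notin [pchar F] -> is_loop op ->
  (forall A B, A \in adjacency_span F (left_mul_rels op) ->
     B \in adjacency_span F (left_mul_rels op) ->
     jordan_mul A B \in adjacency_span F (left_mul_rels op)) ->
  left_alternating op.
Proof.
move=> /two_neq0 F2 op_loop closed a b x.
have [[e [_ op1r]] op_bij] := op_loop.
apply: (eq_pair_of_indicators F2) => y.
have [_ [g _ gK]] := op_bij x; rewrite -[y]gK; set d := g y.
have in_span := closed _ _ (adjacency_mem_span F op b) (adjacency_mem_span F op a).
(* Up to the factor 1/2, the entry at [x] counts how many of a(bx), b(ax) equal dx = y, and the
   entry at [e] how many of ab, ba equal d. *)
have := adjacency_span_const d x e op_loop in_span.
rewrite !jordan_mul_adjacencyE => /(mulfI (invr_neq0 F2)).
rewrite !enum_rankK !op1r => ->.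
by have [_ /bij_inj inj] := op_bij x; rewrite !(inj_eq inj).
Qed.

Lemma left_alternating_jordan_closed (F : fieldType) (S : finType)
    (op : S -> S -> S) :
  left_alternating op ->
  forall A B, A \in adjacency_span F (left_mul_rels op) ->
    B \in adjacency_span F (left_mul_rels op) ->
    jordan_mul A B \in adjacency_span F (left_mul_rels op).
Proof.
move=> alt_op A B.
move/(@coord_span _ _ _ (in_tuple _))=> ->.
move/(@coord_span _ _ _ (in_tuple _))=> ->.
apply: memvZ; rewrite mulmx_suml mulmx_sumr -big_split /=.
apply: memv_suml => i _; rewrite mulmx_sumr mulmx_suml -big_split /=.
apply: memv_suml => j _.
(* Both orders of the product carry the same scalar, so bilinearity reduces the claim to two basic
   matrices. *)
rewrite -!scalemxAl -!scalemxAr !scalerA [X in _ + X *: _]mulrC -scalerDr.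
apply: memvZ.
have /mapP[s] := mem_nth 0 (ltn_ord i).
rewrite mem_enum => /imsetP[a _ ->] ->.
have /mapP[t] := mem_nth 0 (ltn_ord j).
rewrite mem_enum => /imsetP[b _ ->] ->.
have -> : adjacency_mx F (left_mul_rel op a) *m
            adjacency_mx F (left_mul_rel op b) +
          adjacency_mx F (left_mul_rel op b) *m
            adjacency_mx F (left_mul_rel op a) =
          adjacency_mx F (left_mul_rel op (op a b)) +
          adjacency_mx F (left_mul_rel op (op b a)).
  apply/matrixP => k l; rewrite [LHS]mxE [RHS]mxE !adjacency_mulmxE.
  rewrite !adjacency_left_mulE.
  by case: (alt_op a b (enum_val k)) => -[-> ->] //; rewrite addrC.
by rewrite memvD ?adjacency_mem_span.
Qed.

Theorem theorem3p16 (F : fieldType) (F_char : 2%N \notin [pchar F])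
    (S : finType) (op : S -> S -> S) (op_loop : is_loop op) :
  (jordan_scheme F (left_mul_rels op) /\ thin (left_mul_rels op)) <-> RA_loop op.
Proof.
have [[e [op1l op1r]] op_bij] := op_loop.
split=> [[[_ _ conv closed] _] | [_ /loop_ring_alternativeP[altl altr]]].
  have alt_op := jordan_closed_left_alternating F_char op_loop closed.
  (* Closure under converses is the left inverse property: the converse of the relation of [a] is
     that of some [a']. The boolean quantifier lets [xchoose] select it. *)
  have LIP a : exists a', [forall x, op a' (op a x) == x].
    have /imsetP[a' _ eq_conv] := conv _ (left_mul_rel_in op a).
    exists a'; apply/forallP => x; rewrite -mem_left_mul_rel -eq_conv inE.
    by rewrite mem_left_mul_rel eqxx.
  pose inv a := xchoose (LIP a).
  have invK a : cancel (op a) (op (inv a)).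
    by move=> x; apply/eqP; exact: (forallP (xchooseP (LIP a))).
  have Kinv a : cancel (op (inv a)) (op a).
    by have [bij _] := op_bij a; apply/(bij_can_sym bij).
  split=> //; apply/loop_ring_alternativeP; split=> //.
  exact: left_alternating_opposite op1l op1r alt_op invK Kinv.
split; last exact: left_mul_rels_thin.
split; last exact: left_alternating_jordan_closed.
- exact: left_mul_rels_partition.
- by rewrite -(diag_left_mul_rel op1l) left_mul_rel_in.
move=> _ /imsetP[a _ ->].
(* As [g] inverts right multiplication by [a], [a'] is the left inverse of [a]; its relation will be
   the converse. *)
have [_ [g _ gK]] := op_bij a; pose a' := g e.
have [[/bij_inj injl /bij_inj injr] a'a] := (op_bij a', gK e).
have invK := alternating_left_inverse op1l op1r injl injr altl altr a'a.
have Kinv : cancel (op a') (op a).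
  by have [bij _] := op_bij a; apply/(bij_can_sym bij).
suff -> : converse_rel (left_mul_rel op a) = left_mul_rel op a' by rewrite left_mul_rel_in.
apply/setP => -[x y]; rewrite inE /= !mem_left_mul_rel.
by rewrite (can2_eq invK Kinv) eq_sym.
Qed.
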